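(* For every integer $q\geq 2$, \[ \sum_{n=1}^\infty\frac{4^n}{n^q\binom{2n}{n}} =(-1)^q\sum_{n=1}^\infty\frac{H_n\binom{2n}{n}}{4^n n^{q-1}}+\sum_{\substack{k_1+\cdots+k_5=q-2\\k_1,\ldots,k_5\geq0}}G(k_1,k_2,k_3,k_4)\,\zeta(k_5+2)\,. \]
   Context: $H_n=\sum_{k=1}^n1/k$. $G(k_1,k_2,k_3,k_4):=\frac{2^{k_3+k_4}\ln^{k_4}(2)\,C_{k_1}C_{k_2}D_{k_3}}{k_1!k_2!k_3!k_4!}$, where, with the exponential complete Bell polynomials $Y_n$ defined by $\exp\left(\sum_{k\geq1}x_k\frac{t^k}{k!}\right)=\sum_{n\geq0}Y_n(x_1,\ldots,x_n)\frac{t^n}{n!}$, $C_n=Y_n(x_1,\dots,x_n)$ with $x_1=0$, $x_j=(-1)^j(j-1)!\zeta(j)$ ($j\ge2$), and $D_n=Y_n(x_1,\dots,x_n)$ with $x_1=0$, $x_j=(-1)^{j-1}(j-1)!\zeta(j)$ ($j\ge2$). *)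

(* Defs.v *)
From mathcomp Require Import all_boot all_order all_algebra.
From mathcomp Require Import all_classical all_reals all_analysis.

Set Implicit Arguments.
Unset Strict Implicit.
Unset Printing Implicit Defensive.

Import Order.TTheory GRing.Theory Num.Theory.
Import numFieldNormedType.Exports.

Local Open Scope ring_scope.

(* The formal series \sum_(k >= 1) x_k t^k / k!, truncated after t^N. *)
Definition bell_exponent (F : numFieldType) (x : nat -> F) (N : nat) : {poly F} :=
  \sum_(1 <= k < N.+1) (x k / k`!%:R) *: 'X^k.

(* exp(\sum_(k >= 1) x_k t^k / k!), correct up to and including the term t^N:
   the omitted powers m > N of the exponent are divisible by t^(N+1). *)
Definition bell_series (F : numFieldType) (x : nat -> F) (N : nat) : {poly F} :=
  \sum_(0 <= m < N.+1) (m`!%:R)^-1 *: bell_exponent x N ^+ m.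

(* Y_n(x_1, ..., x_n); only the values x 1, ..., x n are used. *)
Definition bellY (F : numFieldType) (x : nat -> F) (n : nat) : F :=
  n`!%:R * (bell_series x n)`_n.

Section Truncation.
Variables (F : numFieldType) (x : nat -> F).

Lemma coef_bell_exponent N i :
  (bell_exponent x N)`_i = if (1 <= i <= N)%N then x i / i`!%:R else 0.
Proof.
rewrite /bell_exponent coef_sum.
under eq_bigr do rewrite coefZ coefXn.
have [/andP[i1 iN]|h] := ifPn.
  rewrite (bigD1_seq i) ?mem_index_iota ?iota_uniq ?i1 //=.
  rewrite eqxx mulr1 big1 ?addr0 // => j ji.
  by rewrite eq_sym (negbTE ji) mulr0.
rewrite big_seq big1 // => j; rewrite mem_index_iota => hj.
by case: eqP => [ij|_]; rewrite ?mulr0 //; rewrite ij -ltnS hj in h.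
Qed.

Lemma coef_bell_exponentX_trunc N n m i : (n <= N)%N -> (i <= n)%N ->
  (bell_exponent x N ^+ m)`_i = (bell_exponent x n ^+ m)`_i.
Proof.
move=> nN; elim: m i => [//|m IH] i ilen; rewrite !exprS !coefM.
apply: eq_bigr => -[j /= ji] _; rewrite IH; last first.
  exact: leq_trans (leq_subr _ _) ilen.
have jn : (j <= n)%N by apply: leq_trans ilen; rewrite -ltnS.
by rewrite !coef_bell_exponent jn (leq_trans jn nN).
Qed.

Lemma coef_bell_exponentX_small N m i : (i < m)%N ->
  (bell_exponent x N ^+ m)`_i = 0.
Proof.
elim: m i => [//|m IH] i im; rewrite exprS coefM big1 // => -[[|j] /= ji] _.
  by rewrite coef_bell_exponent mul0r.
rewrite IH ?mulr0 //; case: i im ji => // i im _.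
by rewrite subSS (leq_ltn_trans (leq_subr _ _)).
Qed.

(* The truncation order is immaterial: any N >= n yields the same Y_n. *)
Lemma bellY_trunc N n : (n <= N)%N ->
  n`!%:R * (bell_series x N)`_n = bellY x n.
Proof.
move=> nN; rewrite /bellY /bell_series !coef_sum; congr (_ * _).
rewrite (big_cat_nat (n := n.+1)) //= [X in _ + X]big_nat.
rewrite [X in _ + X]big1 ?addr0 => [|m /andP[nm _]]; last first.
  by rewrite coefZ coef_bell_exponentX_small ?mulr0.
by apply: eq_bigr => m _; rewrite !coefZ (coef_bell_exponentX_trunc _ nN).
Qed.

End Truncation.

Section Constants.
Variable R : realType.

(* Partial sums of a series indexed from 1; the sum of the series is
   limn (psum u), meaningful when cvgn (psum u). *)
Definition psum (u : nat -> R) (N : nat) : R := \sum_(1 <= n < N) u n.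

(* Only used at integers s >= 2, where the series converges. *)
Definition zeta (s : nat) : R := limn (psum (fun n => (n%:R ^+ s)^-1)).

Definition harm (n : nat) : R := \sum_(1 <= k < n.+1) k%:R^-1.

Definition C_ (n : nat) : R :=
  bellY (fun j => if (j <= 1)%N then 0
                  else (-1) ^+ j * (j.-1)`!%:R * zeta j) n.

Definition D_ (n : nat) : R :=
  bellY (fun j => if (j <= 1)%N then 0
                  else (-1) ^+ j.-1 * (j.-1)`!%:R * zeta j) n.

Definition G (k1 k2 k3 k4 : nat) : R :=
  2 ^+ (k3 + k4) * ln 2 ^+ k4 * C_ k1 * C_ k2 * D_ k3
  / (k1`!%:R * k2`!%:R * k3`!%:R * k4`!%:R).

End Constants.

(* Main.v *)
(* Put b_n = C(2n, n) / 4^n and let g(t) = 1 + \sum_(n >= 1) b_n t / (n + t), so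
   that g(m) = 1 / b_m at every integer m >= 0. Expanding 1 / b_m along g, the
   remainder 1 / b_m - \sum_(k <= q - 2) g_k m^k divided by m^q is, up to the sign
   (-1)^q, the row sum over n of the nonnegative double series
   b_n / (n^(q-2) m (n + m)), whose column sums are b_n H_n / n^(q-1); summing in
   both orders gives the identity with \sum_(k <= q - 2) g_k zeta (q - k) as the
   finite part. It remains to see that g = 4^t Gamma(1 + t)^2 / Gamma(1 + 2t) as
   formal power series, which is the generating function of the Bell polynomial
   products. Since g(t) = t B(t, 1/2), the functional equation
   (m + 1/2 + t) B(m + 1 + t, 1/2) = (m + t) B(m + t, 1/2) expresses the
   logarithmic derivative of g as \sum_m (1 / (m + 1/2 + t) - 1 / (m + 1 + t)),
   whose coefficients are 2 ln 2 and multiples of zeta values. *)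
Require Import Defs.
From mathcomp Require Import all_boot all_order all_algebra.
From mathcomp Require Import all_classical all_reals all_analysis.
From mathcomp Require Import ring lra.

Set Implicit Arguments.
Unset Strict Implicit.
Unset Printing Implicit Defensive.

Import Order.TTheory GRing.Theory Num.Theory.
Import numFieldNormedType.Exports.

Local Open Scope classical_set_scope.
Local Open Scope ring_scope.

(** * Formal power series as coefficient sequences, and their logarithmic derivatives *)

Section FormalSeries.
Variable F : numFieldType.
Implicit Types (f g h l : nat -> F).

Definition conv f g (k : nat) : F := \sum_(i < k.+1) f i * g (k - i)%N.

Definition fderiv f (k : nat) : F := k.+1%:R * f k.+1.

(** The linear series a + t. *)
Definition lin (a : F) (k : nat) : F := if k is k'.+1 then (k' == 0)%:R else a.

Definition trunc (K : nat) f : {poly F} := \poly_(i < K) f i.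

Lemma coef_trunc K f k : (k < K)%N -> (trunc K f)`_k = f k.
Proof. by move=> kK; rewrite coef_poly kK. Qed.

Lemma coef_truncM K f g k : (k < K)%N ->
  (trunc K f * trunc K g)`_k = conv f g k.
Proof.
move=> kK; rewrite coefM; apply: eq_bigr => -[i /= ik] _.
by rewrite !coef_trunc //; apply: leq_ltn_trans kK; rewrite ?leq_subr.
Qed.

Lemma coefM_eq (p p' r r' : {poly F}) k :
  (forall i, (i <= k)%N -> p`_i = p'`_i) ->
  (forall i, (i <= k)%N -> r`_i = r'`_i) -> (p * r)`_k = (p' * r')`_k.
Proof.
move=> pp' rr'; rewrite !coefM; apply: eq_bigr => -[i /= ik] _.
by rewrite pp' // rr' ?leq_subr.
Qed.

Lemma convC f g : conv f g = conv g f.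
Proof.
apply/funext => k.
by rewrite -(@coef_truncM k.+1) // mulrC coef_truncM.
Qed.

Lemma convA f g h : conv f (conv g h) = conv (conv f g) h.
Proof.
apply/funext => k; rewrite -!(@coef_truncM k.+1) //.
transitivity ((trunc k.+1 f * (trunc k.+1 g * trunc k.+1 h))`_k).
  by apply: coefM_eq => // i ik; rewrite coef_trunc ?coef_truncM.
rewrite mulrA; apply: coefM_eq => // i ik.
by rewrite coef_trunc ?coef_truncM.
Qed.

Lemma convDl f g h : conv (f \+ g) h = conv f h \+ conv g h.
Proof.
apply/funext => k; rewrite /= /conv -big_split /=.
by apply: eq_bigr => i _; rewrite mulrDl.
Qed.

Lemma conv0 f g : conv f g 0 = f 0%N * g 0%N.
Proof. by rewrite /conv big_ord_recl big_ord0 addr0. Qed.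

Lemma fderiv_conv f g :
  fderiv (conv f g) = conv (fderiv f) g \+ conv f (fderiv g).
Proof.
apply/funext => k; rewrite /fderiv -(@coef_truncM k.+2) // mulr_natl.
rewrite -coef_deriv derivM coefD /= -!(@coef_truncM k.+1) //.
congr (_ + _); apply: coefM_eq => i ik.
- by rewrite coef_deriv !coef_trunc // mulr_natl.
- by rewrite !coef_trunc // ltnS leqW.
- by rewrite !coef_trunc // ltnS leqW.
- by rewrite coef_deriv !coef_trunc // mulr_natl.
Qed.

Lemma conv_lin a f k : conv (lin a) f k.+1 = a * f k.+1 + f k.
Proof.
rewrite /conv big_ord_recl /= subn0 big_ord_recl /= mul1r subSS subn0.
by rewrite big1 ?addr0 // => i _; rewrite mul0r.
Qed.

Lemma conv_injl f l l' : f 0%N != 0 -> conv l f = conv l' f -> l = l'.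
Proof.
move=> f0 e; apply/funext => k; elim/ltn_ind: k => k IH.
have := congr1 (fun u : nat -> F => u k) e.
rewrite /conv !big_ord_recr /= subnn => ek.
apply: (mulIf f0); apply: (addrI (\sum_(i < k) l i * f (k - i)%N)).
rewrite ek; congr (_ + _).
by apply: eq_bigr => -[i /= ik] _; rewrite IH.
Qed.

(** Each coefficient of f'/f depends on all earlier ones, so the recursion carries the list of those
    already found. *)
Fixpoint logd_seq f (n : nat) : seq F :=
  if n is n'.+1 then
    let s := logd_seq f n' in
    rcons s ((fderiv f n' - \sum_(i < n') s`_i * f (n' - i)%N) / f 0%N)
  else [::].

(* Coefficients of the logarithmic derivative f'/f. *)
Definition logd f (k : nat) : F := (logd_seq f k.+1)`_k.

Lemma size_logd_seq f n : size (logd_seq f n) = n.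
Proof. by elim: n => //= n IH; rewrite size_rcons IH. Qed.

Lemma nth_logd_seq f n k : (k < n)%N -> (logd_seq f n)`_k = logd f k.
Proof.
elim: n => // n IH; rewrite ltnS leq_eqVlt => /orP[/eqP -> //|kn] /=.
by rewrite nth_rcons size_logd_seq kn IH.
Qed.

Lemma logdE f k :
  logd f k = (fderiv f k - \sum_(i < k) logd f i * f (k - i)%N) / f 0%N.
Proof.
rewrite {1}/logd /= nth_rcons size_logd_seq ltnn eqxx.
congr ((_ - _) / _); apply: eq_bigr => -[i /= ik] _.
by rewrite nth_logd_seq.
Qed.

Lemma logdP f : f 0%N != 0 -> fderiv f = conv (logd f) f.
Proof.
move=> f0; apply/funext => k.
rewrite /conv big_ord_recr /= subnn logdE mulfVK //.
by rewrite addrC subrK.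
Qed.

Lemma logd_unique f l : f 0%N != 0 -> fderiv f = conv l f -> logd f = l.
Proof. by move=> f0 e; apply: (conv_injl f0); rewrite -logdP. Qed.

Lemma logd_conv f g : f 0%N != 0 -> g 0%N != 0 ->
  logd (conv f g) = logd f \+ logd g.
Proof.
move=> f0 g0; apply: logd_unique; first by rewrite conv0 mulf_neq0.
rewrite fderiv_conv (logdP f0) (logdP g0) convDl -convA; congr (_ \+ _).
by rewrite !convA (convC f (logd g)).
Qed.

Lemma logd_lin (a : F) k : a != 0 -> logd (lin a) k = (-1) ^+ k / a ^+ k.+1.
Proof.
move=> a0; suff -> : logd (lin a) = fun k => (-1) ^+ k / a ^+ k.+1 by [].
apply: logd_unique => //; rewrite convC; apply/funext => -[|n].
  by rewrite conv0 /fderiv /= !mulr1 expr1 expr0 mul1r mulfV.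
rewrite conv_lin /fderiv /= mulr0 [in RHS]exprS [a ^+ n.+2]exprS.
rewrite invfM; field.
by rewrite expf_neq0.
Qed.

(** The equation f' = l f determines coefficient k + 1 from the earlier ones, since k + 1 is
    invertible in characteristic 0. *)
Lemma logd_inj f g : f 0%N = g 0%N -> f 0%N != 0 -> logd f = logd g -> f = g.
Proof.
move=> fg0 f0 e; apply/funext => k; elim/ltn_ind: k => -[//|k] IH.
have := congr1 (fun u : nat -> F => u k) (logdP f0).
rewrite e /conv.
under eq_bigr => i _ do rewrite IH ?ltnS ?leq_subr //.
rewrite -/(conv (logd g) g k) -logdP -?fg0 // /fderiv.
by apply: mulfI; rewrite pnatr_eq0.
Qed.

(** This is (exp E)' = E' exp E, read off from truncated exponentials. *)
Lemma bell_recurrence (x : nat -> F) :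
  fderiv (fun k => bellY x k / k`!%:R) =
  conv (fun j => x j.+1 / j`!%:R) (fun k => bellY x k / k`!%:R).
Proof.
have fne n : (n`!%:R : F) != 0 by rewrite pnatr_eq0 -lt0n fact_gt0.
apply/funext => k; pose N := k.+1.
have y i : (i <= N)%N -> bellY x i / i`!%:R = (bell_series x N)`_i.
  by move=> iN; rewrite -(bellY_trunc x iN) mulrC mulKf.
rewrite /fderiv y // mulr_natl -coef_deriv.
pose E := bell_exponent x N.
pose T := \sum_(0 <= m < N) (m`!%:R : F)^-1 *: E ^+ m.
have ES : bell_series x N = T + (N`!%:R : F)^-1 *: E ^+ N.
  by rewrite /bell_series big_nat_recr.
(* Differentiating E^m / m! lowers m by one, so the sum [T] stops one power short of
   [bell_series x N]. The missing E^N is divisible by t^N and cannot reach the coefficients k - i <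
   N used below. *)
have -> : deriv (bell_series x N) = deriv E * T.
  rewrite /bell_series big_nat_recl // expr0 derivD derivZ derivC scaler0 add0r.
  rewrite raddf_sum /= mulr_sumr; apply: eq_bigr => m _.
  rewrite derivZ deriv_exp /= -scalerAr [in RHS]mulrC.
  rewrite -[_ *+ m.+1]scaler_nat scalerA.
  congr (_ *: _); last by rewrite mulrC.
  by rewrite factS natrM invfM mulrC mulrA mulfV ?mul1r // pnatr_eq0.
rewrite coefM; apply: eq_bigr => -[i /= ik] _.
rewrite coef_deriv coef_bell_exponent /= -/N -[i.+1]add1n in ik *.
rewrite y; last by rewrite (leq_trans (leq_subr _ _)).
rewrite ES coefD coefZ coef_bell_exponentX_small ?mulr0 ?addr0; last first.
  by rewrite ltnS leq_subr.
congr (_ * _); rewrite add1n in ik *; rewrite ik factS natrM -mulr_natl.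
by field; rewrite fne nat1r pnatr_eq0.
Qed.

Lemma bellY0 (x : nat -> F) : bellY x 0 = 1.
Proof.
by rewrite /bellY /bell_series big_nat1 expr0 coefZ coef1 fact0 invr1 !mulr1.
Qed.

Lemma logd_bell (x : nat -> F) :
  logd (fun k => bellY x k / k`!%:R) = fun j => x j.+1 / j`!%:R.
Proof.
apply: logd_unique; last exact: bell_recurrence.
by rewrite bellY0 fact0 divr1 oner_neq0.
Qed.

Lemma logd_rescale f (a : F) : f 0%N != 0 ->
  logd (fun k => a ^+ k * f k) = fun k => a ^+ k.+1 * logd f k.
Proof.
move=> f0; apply: logd_unique; first by rewrite expr0 mul1r.
apply/funext => k; have := congr1 (fun u : nat -> F => u k) (logdP f0).
rewrite /fderiv /= => e; rewrite mulrCA e /conv mulr_sumr.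
apply: eq_bigr => -[i /= ik] _.
by rewrite mulrACA -exprD addSn subnKC // -mulrA.
Qed.

Lemma logd_exp (a : F) :
  logd (fun k => a ^+ k / k`!%:R) = fun k => (k == 0)%N%:R * a.
Proof.
apply: logd_unique; first by rewrite fact0 expr0 divr1 oner_neq0.
apply/funext => k; rewrite /conv big_ord_recl /= mul1r subn0.
rewrite big1 ?addr0 => [|i _]; last by rewrite !mul0r.
rewrite /fderiv factS natrM exprS; field.
by rewrite !pnatr_eq0 -lt0n fact_gt0 nat1r pnatr_eq0.
Qed.

Lemma coef_mul5 f1 f2 f3 f4 f5 (K n : nat) :
  (trunc K f1 * trunc K f2 * trunc K f3 * trunc K f4 * trunc K f5)`_n =
  \sum_(k1 < K) \sum_(k2 < K) \sum_(k3 < K) \sum_(k4 < K)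
    \sum_(k5 < K | (k1 + k2 + k3 + k4 + k5 == n)%N)
      f1 k1 * f2 k2 * f3 k3 * f4 k4 * f5 k5.
Proof.
have step f p r :
    (p * (trunc K f * r))`_n = \sum_(k < K) (p * (f k *: 'X^k) * r)`_n.
  rewrite /trunc poly_def mulr_suml mulr_sumr coef_sum.
  by apply: eq_bigr => k _; rewrite mulrA.
(* The padding by 1 on both sides puts the product in the shape of [step], which then expands one
   factor at a time. *)
rewrite -!mulrA -[trunc K f5]mulr1 -[trunc K f1 * _]mul1r.
rewrite step; apply: eq_bigr => k1 _; rewrite step; apply: eq_bigr => k2 _.
rewrite step; apply: eq_bigr => k3 _; rewrite step; apply: eq_bigr => k4 _.
rewrite step [RHS]big_mkcond; apply: eq_bigr => k5 _ /=.
set c := f1 k1 * _ * _ * _ * _.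
rewrite mulr1 mul1r !(=^~scalerAl, =^~scalerAr) !scalerA -!exprD coefZ coefXn.
rewrite /c eq_sym; case: eqP => _; rewrite ?mulr0 // mulr1.
by ring.
Qed.

End FormalSeries.

(** * Convergent series, interchange of nonnegative double sums, zeta and harmonic sums *)

Section Sums.
Variable R : realType.
Implicit Types (u v : nat -> R) (a : nat -> nat -> R).

(** A relation rather than a value, so that convergence is always part of the claim. *)
Definition hsum u (s : R) : Prop := series u n @[n --> \oo] --> s.

Lemma hsum_unique u s t : hsum u s -> hsum u t -> s = t.
Proof. by move=> us ut; apply: (cvg_unique _ us ut). Qed.

Lemma eq_hsum u v s : u =1 v -> hsum u s -> hsum v s.
Proof. by move=> /funext ->. Qed.

Lemma hsumD u v s t : hsum u s -> hsum v t -> hsum (fun n => u n + v n) (s + t).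
Proof.
by move=> us vt; rewrite /hsum (seriesD u v); apply: cvgD.
Qed.

Lemma hsumZ c u s : hsum u s -> hsum (fun n => c * u n) (c * s).
Proof.
move=> us; rewrite /hsum (_ : series _ = fun n => c * series u n).
  exact: cvgM (cvg_cst _) us.
by apply/funext => n; rewrite /series /= mulr_sumr.
Qed.

Arguments hsumZ c {u s}.

Lemma hsumB u v s t : hsum u s -> hsum v t -> hsum (fun n => u n - v n) (s - t).
Proof.
move=> us vt; rewrite -[- t]mulN1r.
apply: (@eq_hsum (fun n => u n + -1 * v n)) => [n|]; first by rewrite mulN1r.
exact: hsumD us (hsumZ (-1) vt).
Qed.

Lemma cvg_sum_ord (u : nat -> nat -> R) (s : nat -> R) K :
  (forall k, (k < K)%N -> u k n @[n --> \oo] --> s k) ->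
  \sum_(k < K) u k n @[n --> \oo] --> \sum_(k < K) s k.
Proof.
elim: K => [|K IH] us.
  by under eq_fun do rewrite big_ord0; rewrite big_ord0; exact: cvg_cst.
under eq_fun do rewrite big_ord_recr; rewrite big_ord_recr /=.
by apply: cvgD (us K (ltnSn K)); apply: IH => k kK; exact: us (ltnW kK).
Qed.

Lemma hsum_sum (u : nat -> nat -> R) (s : nat -> R) K :
  (forall k, (k < K)%N -> hsum (u k) (s k)) ->
  hsum (fun n => \sum_(k < K) u k n) (\sum_(k < K) s k).
Proof.
move=> /cvg_sum_ord h; rewrite /hsum (_ : series _ = fun N =>
  \sum_(k < K) series (u k) N) //.
by apply/funext => n; rewrite /series /= exchange_big.
Qed.

Lemma series_shift u n : series u n.+1 = u 0%N + series (fun k => u k.+1) n.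
Proof. by rewrite !seriesEnat /= big_nat_recl. Qed.

Lemma hsumS u s : hsum (fun n => u n.+1) s <-> hsum u (u 0%N + s).
Proof.
rewrite /hsum -(cvg_shiftS (series u)); split => h.
  rewrite (_ : [sequence _]_n = fun n => u 0%N + series (fun k => u k.+1) n).
    exact: cvgD (cvg_cst _) h.
  by apply/funext => n /=; rewrite series_shift.
rewrite (_ : series _ = fun n => series u n.+1 - u 0%N); last first.
  by apply/funext => n; rewrite series_shift addrAC subrr add0r.
rewrite -[s](addrK (u 0%N)) [s + _]addrC.
exact: cvgB h (cvg_cst _).
Qed.

Lemma hsum_telescope v l : v n @[n --> \oo] --> l ->
  hsum (fun n => v n - v n.+1) (v 0%N - l).
Proof.
move=> vl; rewrite /hsum (_ : series _ = fun n => v 0%N - v n).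
  exact: cvgB (cvg_cst _) vl.
apply/funext; elim => [|n IH].
  by rewrite seriesEnat /= big_geq // subrr.
by rewrite seriesSr /= IH addrA subrK.
Qed.

Lemma hsum_le_partial u s n :
  (forall k, 0 <= u k) -> hsum u s -> series u n <= s.
Proof.
move=> u0 us; rewrite -(cvg_lim _ us) //.
apply: nondecreasing_cvgn_le; last by apply/cvg_ex; exists s.
exact: nondecreasing_series.
Qed.

Lemma hsum_ge0 u s : (forall k, 0 <= u k) -> hsum u s -> 0 <= s.
Proof.
move=> u0 us; apply: le_trans (hsum_le_partial 0 u0 us).
by rewrite seriesEnat /= big_geq.
Qed.

Lemma hsum_le u v s t :
  (forall n, u n <= v n) -> hsum u s -> hsum v t -> s <= t.
Proof.
move=> uv us vt; rewrite -subr_ge0.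
apply: (hsum_ge0 _ (hsumB vt us)) => k; by rewrite subr_ge0.
Qed.

Definition tsum u : R := limn (series u).

Lemma hsum_tsum u s : hsum u s -> tsum u = s.
Proof. by move=> us; apply: cvg_lim. Qed.

Lemma bounded_hsum u M : (forall k, 0 <= u k) -> (forall n, series u n <= M) ->
  hsum u (tsum u).
Proof.
move=> u0 uM; apply: nondecreasing_is_cvgn; first exact: nondecreasing_series.
by exists M => _ [n _ <-].
Qed.

Lemma dominated_hsum u v s : (forall n, 0 <= u n <= v n) -> hsum v s ->
  hsum u (tsum u).
Proof.
move=> uv vs; have u0 n : 0 <= u n by case/andP: (uv n).
have v0 n : 0 <= v n by case/andP: (uv n) => ? ?; exact: le_trans (u0 n) _.
apply: (@bounded_hsum u s) => // n; apply: le_trans (hsum_le_partial n v0 vs).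
by apply: ler_sum => k _; case/andP: (uv k).
Qed.

(** The partial sums stay below c (v 0 - v n), hence below c v 0; no limit of [v] has to be
    known. *)
Lemma telescope_hsum u v c : 0 <= c -> (forall n, 0 <= v n) ->
  (forall n, 0 <= u n <= c * (v n - v n.+1)) -> hsum u (tsum u).
Proof.
move=> c0 v0 uv; apply: (@bounded_hsum u (c * v 0%N)) => [k|n].
  by case/andP: (uv k).
apply: (@le_trans _ _ (c * (v 0%N - v n))); last first.
  by rewrite ler_wpM2l // lerBlDr lerDl.
elim: n => [|n IH]; first by rewrite seriesEnat /= big_geq // subrr mulr0.
rewrite seriesSr /=; case/andP: (uv n) => _ un.
apply: le_trans (lerD IH un) _; rewrite -mulrDr.
by rewrite addrA subrK.
Qed.

(** The first M rows are summed column by column, and each finite column sum is at most the full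
    one. *)
Lemma double_sum_le a s t T M : (forall m n, 0 <= a m n) ->
  (forall m, hsum (a m) (s m)) -> (forall n, hsum (fun m => a m n) (t n)) ->
  hsum t T -> series s M <= T.
Proof.
move=> a0 hs ht hT; rewrite seriesEord /=.
apply: (hsum_le _ (hsum_sum (fun m (_ : (m < M)%N) => hs m)) hT) => n.
have := hsum_le_partial M (a0^~ n) (ht n).
by rewrite seriesEord.
Qed.

(** Tonelli for series: [double_sum_le] with rows and columns exchanged first bounds the partial
    sums of [t], and then the two versions give the two inequalities. *)
Lemma double_sum_swap a s t T : (forall m n, 0 <= a m n) ->
  (forall m, hsum (a m) (s m)) -> (forall n, hsum (fun m => a m n) (t n)) ->
  hsum s T -> hsum t T.
Proof.
move=> a0 hs ht hT.
have t0 n : 0 <= t n by apply: hsum_ge0 (ht n).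
have ht' : hsum t (tsum t).
  apply: (@bounded_hsum t T) => // N.
  exact: (@double_sum_le (fun m n => a n m) t s).
suff -> : T = tsum t by [].
apply/le_anti/andP; split.
  apply: (cvgr_to_le hT); apply: nearW => N /=.
  exact: (double_sum_le N a0 hs ht ht').
apply: (cvgr_to_le ht'); apply: nearW => N /=.
exact: (@double_sum_le (fun m n => a n m) t s).
Qed.

Lemma psum_hsum u s : hsum (fun n => u n.+1) s -> psum u n @[n --> \oo] --> s.
Proof.
move=> us; rewrite -cvg_shiftS.
rewrite (_ : [sequence _]_n = series (fun n => u n.+1)) //.
by apply/funext => n; rewrite /= /psum seriesEnat /= big_add1.
Qed.

Lemma inv_natS_cvg0 : (n.+1%:R : R)^-1 @[n --> \oo] --> (0 : R).
Proof. exact: cvg_harmonic. Qed.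

Arguments inv_natS_cvg0 : clear implicits.

Lemma hsum_zeta s : (2 <= s)%N -> hsum (fun n => (n.+1%:R ^+ s)^-1) (zeta R s).
Proof.
move=> s2; suff h : hsum (fun n => (n.+1%:R ^+ s)^-1)
    (tsum (fun n => (n.+1%:R ^+ s)^-1)).
  by rewrite /zeta (cvg_lim _ (psum_hsum (u := fun n => (n%:R ^+ s)^-1) h)).
(* With x = n + 1, the constant 2 works because 1/x - 1/(x + 1) = 1/(x (x + 1)) and x + 1 <= 2 x. *)
apply: (@telescope_hsum _ (fun n => n.+1%:R^-1) 2) => // n.
rewrite invr_ge0 exprn_ge0 //=.
apply: (@le_trans _ _ (n.+1%:R ^+ 2)^-1).
  by rewrite lef_pV2 ?posrE ?exprn_gt0 // ler_weXn2l // ler1n.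
rewrite -[n.+2]addn1 natrD; set x : R := n.+1%:R.
have x1 : 1 <= x by rewrite ler1n.
have -> : x^-1 - (x + 1)^-1 = (x * (x + 1))^-1.
  by field; apply/andP; split; apply: lt0r_neq0; lra.
rewrite expr2 !invfM [2 * _]mulrCA ler_wpM2l ?invr_ge0; try lra.
by rewrite ler_pdivlMr ?ler_pdivrMl; lra.
Qed.

(** Passing from j to j + 1 adds a telescoping series with sum 1/(j + 1). *)
Lemma hsum_harm j :
  hsum (fun m => m.+1%:R^-1 - (m.+1 + j)%:R^-1) (harm R j).
Proof.
elim: j => [|j IH].
  apply: (@eq_hsum (fun=> 0)); first by move=> n; rewrite addn0 subrr.
  rewrite /harm big_geq // /hsum (_ : series _ = cst 0); first exact: cvg_cst.
  by apply/funext => n; rewrite /series /= big1.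
have -> : harm R j.+1 = harm R j + j.+1%:R^-1 by rewrite /harm big_nat_recr.
have ht : hsum (fun m => (m.+1 + j)%:R^-1 - (m.+2 + j)%:R^-1) (j.+1%:R^-1).
  have := @hsum_telescope (fun m => (m.+1 + j)%:R^-1) 0.
  rewrite subr0; apply.
  by have := inv_natS_cvg0; rewrite -(cvg_shiftn j).
apply: eq_hsum (hsumD IH ht) => m.
by rewrite addrA subrK addSnnS.
Qed.

End Sums.

Arguments hsumZ {R} c {u s}.
Arguments inv_natS_cvg0 : clear implicits.
Arguments hsum_harm : clear implicits.

Unset Implicit Arguments.

(** * Central binomial coefficients and the Taylor coefficients of the Beta function *)

Section CentralBinomial.
Variable R : realType.

Definition cbin (n : nat) : R := 'C(2 * n, n)%:R / 4 ^+ n.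

Lemma cbin0 : cbin 0 = 1.
Proof. by rewrite /cbin muln0 bin0 expr0 divr1. Qed.

Lemma cbin_gt0 n : 0 < cbin n.
Proof.
rewrite divr_gt0 ?exprn_gt0 // ltr0n bin_gt0.
by rewrite mul2n -addnn leq_addr.
Qed.

Lemma cbin_ge0 n : 0 <= cbin n.
Proof. exact: ltW (cbin_gt0 n). Qed.

Lemma cbinS n : n.+1%:R * cbin n.+1 = (n%:R + 2^-1) * cbin n.
Proof.
have e : (n.+1 * 'C(2 * n.+1, n.+1) = 2 * ((2 * n).+1 * 'C(2 * n, n)))%N.
  rewrite [(2 * n.+1)%N](_ : _ = (2 * n).+2); last by rewrite mulnS.
  have h1 := mul_bin_diag (2 * n).+2 n; have h2 := mul_bin_diag (2 * n).+1 n.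
  have h3 : 'C((2 * n).+1, n.+1) = 'C((2 * n).+1, n).
    by rewrite -bin_sub ?subSS mul2n -addnn ?addnK // ltnS leq_addr.
  move: h1 h2 => /= h1 h2; rewrite h3 in h2.
  rewrite h2 -h1 mulnA; congr (_ * _)%N.
  by rewrite mulnS.
have := congr1 (fun i : nat => i%:R : R) e.
rewrite !natrM -[(2 * n).+1]addn1 natrD natrM => eR.
rewrite /cbin [LHS]mulrA eR exprS; field.
by rewrite expf_neq0.
Qed.

Lemma cbinSE n : cbin n.+1 = (n%:R + 2^-1) / n.+1%:R * cbin n.
Proof. by rewrite mulrAC -cbinS mulrAC mulfV ?mul1r // pnatr_eq0. Qed.

(** The recurrence makes b_n / (n + 1) telescope; the resulting series, of sum 2, dominates every
    [bterm m k]. *)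
Lemma cbin_diff n : cbin n / n.+1%:R = 2 * (cbin n - cbin n.+1).
Proof.
have n1 : (n.+1%:R : R) != 0 by rewrite pnatr_eq0.
apply: (mulfI n1); rewrite mulrCA mulfV // mulr1 mulrCA mulrBr cbinS.
by rewrite -[n.+1]addn1 natrD; field.
Qed.

Lemma cbin_le n : cbin n.+1 <= cbin n.
Proof.
have : 0 <= cbin n / n.+1%:R by rewrite divr_ge0 ?cbin_ge0.
by rewrite cbin_diff pmulr_rge0 // subr_ge0.
Qed.

(** An elementary form of b_n = O(n^(-1/2)). The induction step amounts to (2n + 1)(2n + 3) <= 4 (n
    + 1)^2. *)
Lemma cbin_sqr n : cbin n ^+ 2 * (2 * n%:R + 1) <= 1.
Proof.
elim: n => [|n IH]; first by rewrite cbin0 mulr0 add0r expr1n mul1r.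
apply: le_trans IH.
have x0 : 0 <= n%:R :> R by [].
rewrite cbinSE -[n.+1]addn1 natrD; set x : R := n%:R in x0 *.
rewrite exprMn mulrAC [_ * cbin n ^+ 2]mulrC ler_wpM2l ?sqr_ge0 //.
rewrite expr_div_n mulrAC ler_pdivrMr ?exprn_gt0 //; last by lra.
by nra.
Qed.

Lemma cbin_cvg0 : cbin n @[n --> \oo] --> 0.
Proof.
apply/cvgrPdist_le => e e0; have e2 : 0 < e ^+ 2 by rewrite exprn_gt0.
near=> n; rewrite sub0r normrN ger0_norm ?cbin_ge0 //.
rewrite -(@ler_pXn2r _ 2) ?nnegrE ?cbin_ge0 ?(ltW e0) //.
apply: (@le_trans _ _ (n.+1%:R^-1)).
  rewrite -[leRHS]mul1r ler_pdivlMr //.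
  apply: le_trans (cbin_sqr n); rewrite ler_wpM2l ?sqr_ge0 //.
  by rewrite -[n.+1]addn1 natrD lerD2r -natrM ler_nat leq_pmull.
near: n; have := inv_natS_cvg0 R.
move=> /cvgrPdist_le /(_ _ e2); apply: filterS => n /=.
by rewrite sub0r normrN ger0_norm.
Unshelve. all: by end_near. Qed.

Lemma hsum_cbin_diff : hsum (fun n => cbin n / n.+1%:R) 2.
Proof.
have := hsum_telescope cbin_cvg0; rewrite subr0 cbin0 => h.
have := hsumZ 2 h; rewrite mulr1; apply: eq_hsum => n.
by rewrite cbin_diff.
Qed.

Definition bterm (m k n : nat) : R := cbin n / (n + m).+1%:R ^+ k.+1.

Lemma bterm_ge0 m k n : 0 <= bterm m k n.
Proof. by rewrite divr_ge0 ?cbin_ge0 ?exprn_ge0. Qed.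

Lemma hsum_bterm m k : hsum (bterm m k) (tsum (bterm m k)).
Proof.
apply: dominated_hsum hsum_cbin_diff => n; rewrite bterm_ge0 /=.
rewrite ler_wpM2l ?cbin_ge0 // lef_pV2 ?posrE ?exprn_gt0 ?ltr0n //.
apply: (@le_trans _ _ (n + m).+1%:R); first by rewrite ler_nat ltnS leq_addr.
by rewrite -{1}[_%:R]expr1 ler_weXn2l // ler1n.
Qed.

(* [betac m] is the Taylor series at t = 0 of
   B(m + 1 + t, 1/2) = \sum_(n >= 0) cbin n / (n + m + 1 + t). *)
Definition betac (m k : nat) : R := (-1) ^+ k * tsum (bterm m k).

(** The value of B(m + 1, 1/2), by induction on m through the functional equation at t = 0. *)
Lemma tsum_bterm0 m : tsum (bterm m 0) = (cbin m.+1 * m.+1%:R)^-1.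
Proof.
elim: m => [|m IH].
  have h : cbin 1 = 2^-1.
    by have := cbinS 0; rewrite cbin0 mul1r add0r mulr1.
  rewrite h mulr1 invrK; apply: hsum_tsum; apply: eq_hsum hsum_cbin_diff => n.
  by rewrite /bterm addn0 expr1.
(* The increments of [v] sum to 0, and adding them to (m + 1) [bterm m 0] gives exactly (m + 3/2)
   [bterm m.+1 0], term by term. *)
pose v n : R := n%:R * cbin n / (n + m).+1%:R.
have v0 : v n @[n --> \oo] --> 0.
  apply: (squeeze_cvgr _ (cvg_cst 0) cbin_cvg0); apply: nearW => n /=.
  rewrite divr_ge0 ?mulr_ge0 ?cbin_ge0 //= ler_pdivrMr ?ltr0n //.
  by rewrite mulrC ler_wpM2l ?cbin_ge0 // ler_nat leqW // leq_addr.
have := hsum_telescope v0; rewrite subr0 [v 0%N]/v !mul0r => hv.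
have := hsumD (hsumZ m.+1%:R (hsum_bterm m 0)) hv.
rewrite addr0 => /hsum_tsum h.
have m0 : (m%:R : R) >= 0 by [].
have m1 : m.+1%:R + 2^-1 != 0 :> R by rewrite -[m.+1]addn1 natrD; lra.
have b0 : cbin m.+1 != 0 by rewrite gt_eqF ?cbin_gt0.
have -> : (cbin m.+2 * m.+2%:R)^-1 = (m.+1%:R + 2^-1)^-1 * (cbin m.+1)^-1.
  by rewrite mulrC cbinS invfM.
apply: (mulfI m1); rewrite mulrA mulfV // mul1r.
rewrite IH invfM mulrCA mulfV ?pnatr_eq0 // mulr1 in h.
rewrite -h -(hsum_tsum (hsumZ (m.+1%:R + 2^-1) (hsum_bterm m.+1 0))).
congr tsum; apply/funext => n; rewrite /bterm /v !expr1 cbinS addnS !addSn.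
rewrite -[(n + m).+2]addn1 -[(n + m).+1]addn1 -[m.+1]addn1 !natrD.
have n0 : (n%:R : R) >= 0 by [].
by field; apply/andP; split; lra.
Qed.

Lemma betac0_gt0 m : 0 < betac m 0.
Proof.
by rewrite /betac expr0 mul1r tsum_bterm0 invr_gt0 mulr_gt0 ?cbin_gt0.
Qed.

Lemma betac0_neq0 m : betac m 0 != 0.
Proof. by rewrite gt_eqF ?betac0_gt0. Qed.

(* (m + 3/2 + t) B(m + 2 + t, 1/2) = (m + 1 + t) B(m + 1 + t, 1/2) *)
Lemma betac_functional m :
  conv (lin (m.+1%:R + 2^-1)) (betac m.+1) = conv (lin m.+1%:R) (betac m).
Proof.
apply/funext => -[|k].
  have b : cbin m.+2 = (m.+1%:R + 2^-1) * cbin m.+1 / m.+2%:R.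
    by rewrite -cbinS mulrC mulKf // pnatr_eq0.
  have b0 : cbin m.+1 != 0 by rewrite gt_eqF ?cbin_gt0.
  rewrite !conv0 /betac !expr0 !mul1r /= !tsum_bterm0 b.
  have m0 : (m%:R : R) >= 0 by [].
  rewrite -[m.+2]addn2 -[m.+1]addn1 !natrD in b0 *; field.
  by rewrite b0; repeat (apply/andP; split => //); lra.
have e a j : a * betac j k.+1 + betac j k =
    (-1) ^+ k * (tsum (bterm j k) - a * tsum (bterm j k.+1)).
  by rewrite /betac exprS; ring.
rewrite !conv_lin !e; congr (_ * _).
have h := hsumB (hsum_bterm m k) (hsumZ m.+1%:R (hsum_bterm m k.+1)).
have h' := hsumB (hsum_bterm m.+1 k)
  (hsumZ (m.+1%:R + 2^-1) (hsum_bterm m.+1 k.+1)).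
apply: hsum_unique h; rewrite -[X in hsum _ X]add0r.
(* The n = 0 term on the [m] side vanishes. Dropping it shifts n by one, after which both sides have
   the denominators n + m + 2 and agree termwise by the recurrence of [cbin]. *)
have {1}-> : 0 = bterm m k 0 - m.+1%:R * bterm m k.+1 0.
  rewrite /bterm cbin0 add0n [_ ^+ k.+2]exprS; field.
  by rewrite nat1r pnatr_eq0 expf_neq0 // nat1r pnatr_eq0.
apply/hsumS; apply: eq_hsum h' => n.
have -> : bterm m k n.+1 = (n%:R + 2^-1) / n.+1%:R * bterm m.+1 k n.
  by rewrite /bterm addSnnS mulrA cbinSE.
have -> : bterm m k.+1 n.+1 =
    (n%:R + 2^-1) / n.+1%:R * bterm m.+1 k n / (n + m).+2%:R.
  rewrite /bterm addSnnS cbinSE [_ ^+ k.+2]exprSr invfM addnS.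
  by move: (cbin n) => c; rewrite !mulrA.
have -> : bterm m.+1 k.+1 n = bterm m.+1 k n / (n + m).+2%:R.
  by rewrite /bterm addnS [_ ^+ k.+2]exprSr invfM !mulrA.
rewrite -[(n + m).+2]addn2 -[m.+1]addn1 -[n.+1]addn1 !natrD.
have n0 : (n%:R : R) >= 0 by []. have m0 : (m%:R : R) >= 0 by [].
by field; repeat (apply/andP; split => //); lra.
Qed.

(** Termwise, (n + m + 1)^(k + 2) >= (m + 1)(n + m + 1). Hence B(m + 1 + t, 1/2), normalised at t =
    0, tends to the constant series 1 as m grows. *)
Lemma betac_ratio m k : `|betac m k.+1 / betac m 0| <= m.+1%:R^-1.
Proof.
have b0 := betac0_gt0 m; have t0 j : 0 <= tsum (bterm m j).
  exact: hsum_ge0 (bterm_ge0 m j) (hsum_bterm m j).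
rewrite normrM normfV (gtr0_norm b0) ler_pdivrMr //.
rewrite /betac normrM normrX normrN1 expr1n mul1r expr0 mul1r ger0_norm //.
apply: hsum_le (hsum_bterm m k.+1) (hsumZ m.+1%:R^-1 (hsum_bterm m 0)).
move=> n; rewrite /bterm mulrCA ler_wpM2l ?cbin_ge0 // expr1 -invfM.
rewrite lef_pV2 ?posrE ?exprn_gt0 ?mulr_gt0 ?ltr0n // [leRHS]exprS.
apply: ler_pM => //; first by rewrite ler_nat ltnS leq_addl.
by rewrite -{1}[_%:R]expr1 ler_weXn2l // ler1n.
Qed.

Lemma betac_ratio_cvg0 k : betac m k.+1 / betac m 0 @[m --> \oo] --> 0.
Proof.
apply/norm_cvg0P; apply: (squeeze_cvgr _ (cvg_cst 0) (inv_natS_cvg0 R)).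
by apply: nearW => m; rewrite normr_ge0 betac_ratio.
Qed.

(** Strong induction on the recursion [logdE]: every term contains a normalised coefficient of
    positive index, which tends to 0. *)
Lemma logd_betac_cvg0 k : logd (betac m) k @[m --> \oo] --> 0.
Proof.
elim/ltn_ind: k => k IH.
rewrite (_ : (fun m => _) = fun m => k.+1%:R * (betac m k.+1 / betac m 0) -
    \sum_(i < k) logd (betac m) i * (betac m (k - i).-1.+1 / betac m 0)).
  have h i : (i < k)%N -> logd (betac m) i *
      (betac m (k - i).-1.+1 / betac m 0) @[m --> \oo] --> (0 * 0 : R).
    by move=> ik; exact: cvgM (IH i ik) (betac_ratio_cvg0 _).
  have := cvgB (cvgM (cvg_cst (k.+1%:R : R)) (betac_ratio_cvg0 k))
    (cvg_sum_ord h).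
  rewrite (_ : k.+1%:R * 0 - \sum_(i < k) 0 * 0 = 0 :> R); first by apply.
  by rewrite mulr0 big1 ?subr0 // => i _; rewrite mulr0.
apply/funext => m; rewrite logdE mulrBl mulrA mulr_suml; congr (_ - _).
by apply: eq_bigr => -[i ik] _ /=; rewrite prednK ?subn_gt0 // -mulrA.
Qed.

(* Taylor coefficients at 0 of 1 + \sum_(n >= 1) cbin n * t / (n + t). *)
Definition gcoef (k : nat) : R :=
  if k is k'.+1 then (-1) ^+ k' * tsum (fun n => cbin n.+1 / n.+1%:R ^+ k)
  else 1.

Lemma hsum_gcoef k : hsum (fun n => cbin n.+1 / n.+1%:R ^+ k.+1)
  ((-1) ^+ k * gcoef k.+1).
Proof.
rewrite /= mulrA -expr2 -exprM mulnC exprM sqrrN expr1n expr1n mul1r.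
apply: dominated_hsum (hsum_bterm 0 k) => n.
rewrite divr_ge0 ?cbin_ge0 ?exprn_ge0 //= /bterm addn0.
by rewrite ler_wpM2r ?invr_ge0 ?exprn_ge0 ?cbin_le.
Qed.

(** This is g(t) = t B(t, 1/2) = (1/2 + t) B(1 + t, 1/2), checked termwise from b_(n+1) = (n + 1/2)
    b_n / (n + 1). *)
Lemma gcoefE : gcoef = conv (lin 2^-1) (betac 0).
Proof.
apply/funext => -[|k].
  rewrite conv0 /betac /= tsum_bterm0 expr0 mul1r mulr1.
  have := cbinS 0; rewrite cbin0 mul1r add0r mulr1 => ->.
  by rewrite invrK mulVf // pnatr_eq0.
have e : 2^-1 * betac 0 k.+1 + betac 0 k =
    (-1) ^+ k * (tsum (bterm 0 k) - 2^-1 * tsum (bterm 0 k.+1)).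
  by rewrite /betac exprS; ring.
rewrite conv_lin e /=; congr (_ * _); apply: hsum_tsum.
apply: eq_hsum (hsumB (hsum_bterm 0 k)
  (hsumZ 2^-1 (hsum_bterm 0 k.+1))) => n.
rewrite cbinSE /bterm addn0 [_ ^+ k.+2]exprS -[n.+1]addn1 natrD; field.
have n0 : (n%:R : R) >= 0 by [].
by rewrite expf_neq0 //; repeat (apply/andP; split => //); lra.
Qed.

(** * The double series, summed by rows and by columns *)

Lemma hsum_gvalue m : hsum (fun n => cbin n.+1 / (n + m).+2%:R)
  (((cbin m.+1)^-1 - 1) / m.+1%:R).
Proof.
(* The claim is g(m + 1) = 1/b_(m+1) solved for its series, which is [bterm m 0] without its first
   term 1/(m + 1). *)
apply: (@eq_hsum _ (fun n => bterm m 0 n.+1)) => [n|].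
  by rewrite /bterm addSn expr1.
apply/hsumS; rewrite [X in hsum _ X](_ : _ = tsum (bterm m 0)).
  exact: hsum_bterm.
rewrite tsum_bterm0 /bterm add0n expr1 cbin0; move: (cbin m.+1) => c.
by rewrite invfM mulrBl mul1r addrC subrK.
Qed.

Lemma summable_inv_cbin p : hsum (fun n => (cbin n.+1)^-1 / n.+1%:R ^+ p.+2)
  (tsum (fun n => (cbin n.+1)^-1 / n.+1%:R ^+ p.+2)).
Proof.
(* With x = n + 1, the increments are 1/(b_x x (2x + 1)), and 2x + 1 <= 3x explains the constant
   3. *)
apply: (@telescope_hsum _ _ (fun n => (cbin n.+1 * n.+1%:R)^-1) 3) => // n.
  by rewrite invr_ge0 mulr_ge0 ?cbin_ge0.
have b0 := cbin_gt0 n.+1.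
have n0 : 0 <= n%:R :> R by [].
rewrite divr_ge0 ?exprn_ge0 ?invr_ge0 ?cbin_ge0 //=.
rewrite [cbin n.+2 * _]mulrC cbinS.
rewrite [(cbin n.+1 * _)^-1]invfM [((_ + _) * _)^-1]invfM.
apply: (@le_trans _ _ ((cbin n.+1)^-1 / n.+1%:R ^+ 2)).
  rewrite ler_wpM2l ?invr_ge0 ?cbin_ge0 //.
  by rewrite lef_pV2 ?posrE ?exprn_gt0 ?ltr0n // ler_weXn2l // ler1n.
rewrite [(n.+1%:R + 2^-1)^-1 * _]mulrC -mulrBr mulrCA.
rewrite ler_wpM2l ?invr_ge0 ?cbin_ge0 //.
set x : R := n.+1%:R; have x1 : 1 <= x by rewrite ler1n.
have -> : x^-1 - (x + 2^-1)^-1 = (x * (2 * x + 1))^-1.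
  by field; repeat (apply/andP; split); lra.
rewrite -[leLHS]mul1r ler_pdivrMr ?exprn_gt0 //.
by rewrite mulrAC ler_pdivlMr; nra.
Qed.

(** With x = n + 1 and y = m + 1, partial fractions write the term for p + 1 as 1/y times the
    difference of b_x / (y x^(p+1)) and the term for p. Each induction step thus subtracts one more
    Taylor coefficient of g. *)
Lemma row_sum p m : hsum
  (fun n => cbin n.+1 / (n.+1%:R ^+ p * m.+1%:R * (n + m).+2%:R))
  ((-1) ^+ p * ((cbin m.+1)^-1 - \sum_(k < p.+1) gcoef k * m.+1%:R ^+ k)
    / m.+1%:R ^+ p.+2).
Proof.
have m0 : (m.+1%:R : R) != 0 by rewrite pnatr_eq0.
elim: p => [|p IH].
  rewrite [X in hsum _ X](_ : _ =
      m.+1%:R^-1 * (((cbin m.+1)^-1 - 1) / m.+1%:R)).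
    have h := hsumZ m.+1%:R^-1 (hsum_gvalue m). apply: eq_hsum h => n.
    by rewrite expr0 mul1r invfM mulrCA.
  by rewrite big_ord1 /= !expr0; field; rewrite nat1r m0 gt_eqF ?cbin_gt0.
have h := hsumZ (m.+1%:R^-1) (hsumB (hsumZ m.+1%:R^-1 (hsum_gcoef p)) IH).
pose g := gcoef p.+1; pose S := \sum_(k < p.+1) gcoef k * m.+1%:R ^+ k.
rewrite (_ : \sum_(k < p.+2) _ = S + g * m.+1%:R ^+ p.+1); last first.
  by rewrite big_ord_recr.
rewrite [X in hsum _ X](_ : _ = m.+1%:R^-1 *
  (m.+1%:R^-1 * ((-1) ^+ p * g) -
   (-1) ^+ p * ((cbin m.+1)^-1 - S) / m.+1%:R ^+ p.+2)).
  apply: eq_hsum h => n.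
  have n0 : (n.+1%:R : R) != 0 by rewrite pnatr_eq0.
  have -> : ((n + m).+2%:R : R) = n.+1%:R + m.+1%:R.
    by rewrite -natrD addSn addnS.
  have nm0 : n.+1%:R + m.+1%:R != 0 :> R by rewrite -natrD pnatr_eq0.
  move: (n.+1%:R) (m.+1%:R) n0 m0 nm0 => x y x0 y0 xy0.
  rewrite exprS; field.
  by rewrite xy0 y0 x0 expf_neq0.
have c0 : cbin m.+1 != 0 by rewrite gt_eqF ?cbin_gt0.
move: S g (m.+1%:R) (cbin m.+1) m0 c0 {h IH} => S g x c x0 c0.
by rewrite !exprS; field; rewrite x0 c0 expf_neq0.
Qed.

(** Here 1/(y (x + y)) = (1/y - 1/(x + y))/x, whose sum over y is [harm R x] / x. *)
Lemma column_sum p n : hsum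
  (fun m => cbin n.+1 / (n.+1%:R ^+ p * m.+1%:R * (n + m).+2%:R))
  (cbin n.+1 * harm R n.+1 / n.+1%:R ^+ p.+1).
Proof.
have n0 : (n.+1%:R : R) != 0 by rewrite pnatr_eq0.
rewrite mulrAC; apply: eq_hsum (hsumZ _ (hsum_harm R n.+1)) => m.
have m0 : (m.+1%:R : R) != 0 by rewrite pnatr_eq0.
have -> : ((n + m).+2%:R : R) = n.+1%:R + m.+1%:R by rewrite -natrD addSn addnS.
have nm0 : n.+1%:R + m.+1%:R != 0 :> R by rewrite -natrD pnatr_eq0.
rewrite natrD exprS.
move: (n.+1%:R) (m.+1%:R) n0 m0 nm0 => x y x0 y0 xy0; field.
by rewrite x0 y0 xy0 expf_neq0.
Qed.

Lemma double_series p :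
  let La := tsum (fun m => (cbin m.+1)^-1 / m.+1%:R ^+ p.+2) in
  hsum (fun n => cbin n.+1 * harm R n.+1 / n.+1%:R ^+ p.+1)
    ((-1) ^+ p * (La - \sum_(k < p.+1) gcoef k * zeta R (p.+2 - k))).
Proof.
move=> La; apply: (@double_sum_swap R (fun m n =>
  cbin n.+1 / (n.+1%:R ^+ p * m.+1%:R * (n + m).+2%:R)) _ _ _ _
  (row_sum p) (column_sum p)).
  by move=> m n; rewrite divr_ge0 ?cbin_ge0 // !mulr_ge0 ?exprn_ge0.
have hz : hsum (fun m => \sum_(k < p.+1) gcoef k * (m.+1%:R ^+ (p.+2 - k))^-1)
    (\sum_(k < p.+1) gcoef k * zeta R (p.+2 - k)).
  apply: (hsum_sum (u := fun k m => gcoef k * (m.+1%:R ^+ (p.+2 - k))^-1)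
    (s := fun k => gcoef k * zeta R (p.+2 - k))) => k kp.
  (* Since k <= p, the exponent p + 2 - k is at least 2 and each zeta series converges
     separately. *)
  by apply: hsumZ; apply: hsum_zeta; rewrite ltn_subRL addn1 ltnS.
apply: eq_hsum (hsumZ _ (hsumB (summable_inv_cbin p) hz)) => m.
rewrite -mulrA mulrBl; congr (_ * (_ - _)); rewrite mulr_suml.
apply: eq_bigr => -[k /= kp] _; rewrite -mulrA; congr (_ * _).
have m0 : (m.+1%:R : R) != 0 by rewrite pnatr_eq0.
have -> : m.+1%:R ^+ p.+2 = m.+1%:R ^+ (p.+2 - k) * m.+1%:R ^+ k :> R.
  by rewrite -exprD subnK // leqW // ltnW.
by field; rewrite !expf_neq0.
Qed.

End CentralBinomial.

(** * The logarithmic derivative of g *)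

Section LogDerivative.
Variable R : realType.
Notation cbin := (cbin R).
Notation betac := (betac R).
Notation gcoef := (gcoef R).

Lemma half_neq0 n : n%:R + 2^-1 != 0 :> R.
Proof. by have : 0 <= n%:R :> R by []; lra. Qed.

(** The functional equation applied N times; the last bracket is the remainder, which vanishes as N
    grows. *)
Lemma logd_gcoef_partial N k : logd gcoef k =
  \sum_(m < N) (logd (lin (m%:R + 2^-1)) k - logd (lin m.+1%:R) k) +
  (logd (lin (N%:R + 2^-1)) k + logd (betac N) k).
Proof.
elim: N => [|N ->].
  rewrite big_ord0 !add0r gcoefE logd_conv ?betac0_neq0 //.
  by have := half_neq0 0; rewrite add0r.
rewrite big_ord_recr /= -addrA; congr (_ + _).
have := congr1 (fun f => logd f k) (betac_functional R N).
rewrite !logd_conv ?betac0_neq0 ?half_neq0 //=.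
move=> e; rewrite e addrA subrK //.
Qed.

(** As m + 1/2 = (2m + 1)/2, this is a sum over odd integers: all integers up to 2N minus the even
    ones. *)
Lemma sum_inv_half N s : \sum_(m < N) ((m%:R + 2^-1) ^+ s)^-1 =
  2 ^+ s * (\sum_(i < 2 * N) (i.+1%:R ^+ s)^-1) -
  \sum_(i < N) (i.+1%:R ^+ s)^-1 :> R.
Proof.
elim: N => [|N IH]; first by rewrite muln0 !big_ord0 mulr0 subr0.
rewrite mulnS !big_ord_recr /= IH.
have -> : ((2 * N).+1%:R : R) = 2 * (N%:R + 2^-1).
  by rewrite -addn1 natrD natrM; field.
have -> : ((2 * N).+2%:R : R) = 2 * N.+1%:R.
  by rewrite -natrM mulnS.
rewrite !exprMn !invfM !mulrDr !mulVKf ?expf_neq0 //.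
by ring.
Qed.

Lemma cvg_double : (2 * N)%N @[N --> \oo] --> \oo.
Proof.
apply/cvgnyPge => A; near=> N; apply: (@leq_trans N).
  by near: N; exact: nbhs_infty_ge.
by rewrite leq_pmull.
Unshelve. all: by end_near. Qed.

Lemma ln_succ_bounds (x : R) : 0 < x ->
  (x + 1)^-1 <= ln (x + 1) - ln x <= x^-1.
Proof.
move=> x0; have x1 : 0 < x + 1 by lra.
apply/andP; split.
  rewrite -[leRHS]opprB lerNr -ln_div ?posrE //.
  have -> : x / (x + 1) = 1 + - (x + 1)^-1 by field; lra.
  by apply: le_ln1Dx; rewrite ltrN2 invf_lt1; lra.
rewrite -ln_div ?posrE // mulrDl mulfV ?gt_eqF // mul1r.
have xV : 0 < x^-1 by rewrite invr_gt0.
by apply: le_ln1Dx; lra.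
Qed.

(** Sums the bounds of [ln_succ_bounds]; the gaps between upper and lower bounds telescope to 1/N -
    1/(N + n). *)
Lemma harmonic_diff_bounds (N n : nat) : (0 < N)%N ->
  let d : R := \sum_(i < N + n) i.+1%:R^-1 - \sum_(i < N) i.+1%:R^-1 in
  d <= ln (N + n)%:R - ln N%:R <= d + (N%:R^-1 - (N + n)%:R^-1).
Proof.
move=> N0; elim: n => [|n IH] /=; first by rewrite addn0 !subrr addr0 lexx.
rewrite addnS big_ord_recr /= -[(N + n).+1]addn1 natrD.
have : 0 < (N + n)%:R :> R by rewrite ltr0n addn_gt0 N0.
move/ln_succ_bounds/andP => [l u]; case/andP: IH => l' u'.
move: l u l' u'; set S := \sum_(i < N + n) _; set T := \sum_(i < N) _.
set L := ln (_ + 1); set L1 := ln (N + n)%:R; set L0 := ln N%:R.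
set a := (_ + 1)^-1; set b := (N + n)%:R^-1; set c := N%:R^-1.
by move=> *; apply/andP; split; lra.
Qed.

Lemma cvg_harmonic_double :
  \sum_(i < 2 * N) i.+1%:R^-1 - \sum_(i < N) i.+1%:R^-1 @[N --> \oo]
    --> (ln 2 : R).
Proof.
rewrite -cvg_shiftS.
apply: (@squeeze_cvgr _ _ _ _ (fun N => ln 2 - N.+1%:R^-1) (fun=> ln 2)).
- apply: nearW => N /=.
  have := harmonic_diff_bounds N.+1 N.+1 (ltn0Sn N).
  rewrite addnn -mul2n /= natrM lnM ?posrE // addrK => /andP[l u].
  rewrite l andbT lerBlDr; apply: le_trans u _.
  by rewrite lerD2l lerBlDr lerDl invr_ge0.
- rewrite -[X in _ --> X]subr0; apply: cvgB; first exact: cvg_cst.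
  exact: inv_natS_cvg0.
- exact: cvg_cst.
Qed.

Lemma logd_gcoef k : logd gcoef k =
  (-1) ^+ k * (if k == 0%N then 2 * ln 2 else (2 ^+ k.+1 - 2) * zeta R k.+1).
Proof.
pose Z N : R := \sum_(i < N) (i.+1%:R ^+ k.+1)^-1.
have e N : logd gcoef k = (-1) ^+ k * (2 ^+ k.+1 * Z (2 * N)%N - 2 * Z N) +
    ((-1) ^+ k * ((N%:R + 2^-1) ^+ k.+1)^-1 + logd (betac N) k).
  rewrite (logd_gcoef_partial N) logd_lin ?half_neq0 //; congr (_ + _).
  transitivity (\sum_(m < N) (-1) ^+ k *
      (((m%:R + 2^-1) ^+ k.+1)^-1 - (m.+1%:R ^+ k.+1)^-1) : R).
    by apply: eq_bigr => m _; rewrite !logd_lin ?half_neq0 ?pnatr_eq0 // mulrBr.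
  rewrite -mulr_sumr sumrB sum_inv_half; congr (_ * _).
  by rewrite -addrA -opprD mulr_natl.
have h0 : (-1) ^+ k * ((N%:R + 2^-1) ^+ k.+1)^-1 + logd (betac N) k
    @[N --> \oo] --> ((-1) ^+ k * 0 + 0 : R).
  apply: cvgD; last exact: logd_betac_cvg0.
  apply: cvgM; first exact: cvg_cst.
  rewrite -cvg_shiftS.
  apply: (@squeeze_cvgr _ _ _ _ (fun=> 0) (fun N => N.+1%:R^-1)).
  - apply: nearW => N /=; rewrite invr_ge0 exprn_ge0 ?addr_ge0 ?invr_ge0 //=.
    rewrite lef_pV2 ?posrE ?exprn_gt0 ?addr_gt0 ?invr_gt0 //.
    have N1 : 1 <= N.+1%:R :> R by rewrite ler1n.
    apply: (@le_trans _ _ (N.+1%:R + 2^-1)); first lra.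
    by rewrite -{1}[_ + _]expr1 ler_weXn2l //; lra.
  - exact: cvg_cst.
  - exact: inv_natS_cvg0.
have hl : (-1) ^+ k * (2 ^+ k.+1 * Z (2 * N)%N - 2 * Z N) +
    ((-1) ^+ k * ((N%:R + 2^-1) ^+ k.+1)^-1 + logd (betac N) k)
    @[N --> \oo] --> logd gcoef k.
  by under eq_fun do rewrite -e; exact: cvg_cst.
suff h : 2 ^+ k.+1 * Z (2 * N)%N - 2 * Z N @[N --> \oo] -->
    (if k == 0%N then 2 * ln 2 else (2 ^+ k.+1 - 2) * zeta R k.+1 : R).
  have := cvgD (cvgM (cvg_cst ((-1) ^+ k : R)) h) h0.
  by rewrite mulr0 !addr0 => hr; apply: (cvg_unique _ hl (hr _ _ _)).
(* At k = 0, [Z] is the divergent harmonic sum, and only the difference at 2N and N has a limit,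
   namely ln 2. For k > 0 both parts converge separately. *)
case: k @Z {e h0 hl} => [|k] Z /=.
  under eq_fun do rewrite expr1 -mulrBr.
  exact: cvgM (cvg_cst _) cvg_harmonic_double.
have hZ : Z N @[N --> \oo] --> zeta R k.+2.
  by have := @hsum_zeta R k.+2 isT; rewrite /hsum seriesEord.
rewrite mulrBl; apply: cvgB; apply: cvgM; try exact: cvg_cst.
  exact: (cvg_comp _ _ cvg_double hZ).
exact: hZ.
Qed.

(** * Factorisation of g into Bell polynomial series, and the finite sum *)

Definition Ccoef (k : nat) : R := C_ R k / k`!%:R.
Definition Dcoef (k : nat) : R := D_ R k / k`!%:R.

(** [Ccoef] is the series of e^(γt) Γ(1 + t) and [Dcoef] that of its inverse, so the factors of γ
    cancel in 4^t Γ(1 + t)^2 / Γ(1 + 2t). The proof compares constant terms and logarithmic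
    derivatives only. *)
Lemma gcoef_bell : gcoef = conv (conv (conv Ccoef Ccoef)
  (fun k => 2 ^+ k * Dcoef k)) (fun k => (2 * ln 2) ^+ k / k`!%:R).
Proof.
have C0 : Ccoef 0 = 1 by rewrite /Ccoef /C_ bellY0 fact0 divr1.
have D0 : Dcoef 0 = 1 by rewrite /Dcoef /D_ bellY0 fact0 divr1.
have n1 : (1 : R) != 0 by exact: oner_neq0.
apply: logd_inj => /=; rewrite ?conv0 ?C0 ?D0 ?expr0 ?fact0 ?divr1 ?mulr1 //.
rewrite !logd_conv ?conv0 ?C0 ?D0 ?expr0 ?fact0 ?divr1 ?mulr1 //.
rewrite logd_rescale ?D0 // logd_exp /Ccoef /Dcoef !logd_bell.
apply/funext => k; rewrite logd_gcoef /=.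
case: k => [|k] /=; first by rewrite expr0 !mul0r !mulr0 !add0r.
have f0 : (k.+1`!%:R : R) != 0 by rewrite pnatr_eq0 -lt0n fact_gt0.
by rewrite !exprS; field.
Qed.

Lemma G_factor k1 k2 k3 k4 : G R k1 k2 k3 k4 =
  Ccoef k1 * Ccoef k2 * (2 ^+ k3 * Dcoef k3) * ((2 * ln 2) ^+ k4 / k4`!%:R).
Proof.
rewrite /G /Ccoef /Dcoef exprD exprMn; field.
by rewrite !pnatr_eq0 -!lt0n !fact_gt0.
Qed.

Lemma finite_sum_bell p :
  \sum_(k < p.+1) gcoef k * zeta R (p.+2 - k) =
  \sum_(k1 < p.+1) \sum_(k2 < p.+1) \sum_(k3 < p.+1) \sum_(k4 < p.+1)
    \sum_(k5 < p.+1 | (k1 + k2 + k3 + k4 + k5 == p)%N)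
      G R k1 k2 k3 k4 * zeta R (k5 + 2).
Proof.
transitivity (conv gcoef (fun k => zeta R (k + 2)) p).
  apply: eq_bigr => -[k /= kp] _; congr (_ * zeta R _).
  by rewrite addn2 -!subSn // ltnW.
rewrite gcoef_bell -(@coef_truncM _ p.+1) //.
under [RHS]eq_bigr => k1 _ do under eq_bigr => k2 _ do
  under eq_bigr => k3 _ do under eq_bigr => k4 _ do
  under eq_bigr => k5 _ do rewrite G_factor.
rewrite -(coef_mul5 Ccoef Ccoef (fun k => 2 ^+ k * Dcoef k)
  (fun k => (2 * ln 2) ^+ k / k`!%:R) (fun k => zeta R (k + 2))).
(* Each pass replaces one nested convolution by a product of truncations, which agree up to the
   degree in question. *)
apply: coefM_eq => // i ip; rewrite coef_trunc // -(@coef_truncM _ p.+1) //.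
apply: coefM_eq => // j ji; have jp := leq_trans ji ip.
rewrite coef_trunc // -(@coef_truncM _ p.+1) //.
apply: coefM_eq => // l lj; have lp := leq_trans lj jp.
by rewrite coef_trunc // coef_truncM.
Qed.

End LogDerivative.

(* The first two conjuncts say that both infinite series converge, so that the
   sums in the identity are genuine limits. *)
Theorem theorem3p5 (R : realType) (q : nat) (hq : (2 <= q)%N) :
  let a : nat -> R := fun n => 4 ^+ n / (n%:R ^+ q * 'C(2 * n, n)%:R) in
  let b : nat -> R := fun n =>
    harm R n * 'C(2 * n, n)%:R / (4 ^+ n * n%:R ^+ (q - 1)) in
  [/\ cvgn (psum a), cvgn (psum b)
    & limn (psum a) =
      (-1) ^+ q * limn (psum b) +
      \sum_(k1 < q - 1) \sum_(k2 < q - 1) \sum_(k3 < q - 1) \sum_(k4 < q - 1)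
        \sum_(k5 < q - 1 | (k1 + k2 + k3 + k4 + k5 == q - 2)%N)
          G R k1 k2 k3 k4 * zeta R (k5 + 2)].
Proof.
case: q hq => [//|[//|p]] _ a b.
have ha : psum a n @[n --> \oo] -->
    tsum (fun n => (cbin R n.+1)^-1 / n.+1%:R ^+ p.+2).
  apply: psum_hsum; apply: eq_hsum (summable_inv_cbin R p) => n.
  by rewrite /a /cbin invf_div -mulrA -invfM; congr (_ / _); rewrite mulrC.
have hb : psum b n @[n --> \oo] --> (-1) ^+ p *
    (tsum (fun n => (cbin R n.+1)^-1 / n.+1%:R ^+ p.+2) -
     \sum_(k < p.+1) gcoef R k * zeta R (p.+2 - k)).
  apply: psum_hsum; apply: eq_hsum (double_series R p) => n.
  by rewrite /b /cbin subn1 /= invfM; ring.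
split; [by apply: cvgP ha | by apply: cvgP hb |].
rewrite (cvg_lim _ ha) // (cvg_lim _ hb) // subn1 subn2 /= -finite_sum_bell.
(* With q = p + 2, the signs (-1)^q and (-1)^p multiply to 1, and the finite sum cancels. *)
by rewrite mulrA -exprD addSn addSn !exprS -signr_odd oddD addbb expr0; ring.
Qed.
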